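(* Let $T=(V,A)$ be a tournament and $k$ a positive integer such that $T$ has a feedback arc set of at most $k$ arcs. Suppose moreover that: (1) every vertex of $T$ lies in some directed triangle; (2) no arc of $T$ belongs to more than $k$ distinct directed triangles; (3) for every maximal transitive module $V_m$ of $T$, with $p=|V_m|$, $I$ the set of vertices outside $V_m$ that are in-neighbours of the vertices of $V_m$, $O$ the set of vertices outside $V_m$ that are out-neighbours of the vertices of $V_m$, and $Z$ the set of arcs $uv$ of $T$ with $u\in O$ and $v \in I$, we have $|Z| \ge p$. Then $T$ has $O(k\sqrt{k})$ vertices.
   Context: A tournament is a digraph with exactly one arc between every pair of distinct vertices. A feedback arc set is a set of arcs whose removal leaves an acyclic digraph. For a vertex $v$, $N^+(v)$ is its set of out-neighbours. A set $M\subseteq V$ is a module if $N^+(u)\setminus M = N^+(v)\setminus M$ for all $u,v\in M$ (so every vertex outside $M$ is either an in-neighbour of all vertices of $M$ or an out-neighbour of all of them). A transitive module is a module inducing an acyclic (transitive) subtournament; a maximal transitive module is one that is maximal under inclusion among transitive modules. *)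

(* Defs.v *)
From mathcomp Require Import all_boot all_order all_algebra.
From mathcomp Require Import reals.

Set Implicit Arguments.
Unset Strict Implicit.
Unset Printing Implicit Defensive.

(* A digraph on a finite vertex type V is its arc relation A : rel V. *)

Definition tournament (V : finType) (A : rel V) : Prop :=
  irreflexive A /\ forall u v : V, u != v -> A u v (+) A v u.

Definition arcs (V : finType) (A : rel V) : {set V * V} :=
  [set a | A a.1 a.2].

Definition outnbr (V : finType) (A : rel V) (v : V) : {set V} :=
  [set w | A v w].

(* Loops and 2-cycles count as directed cycles. *)
Definition acyclic (V : finType) (A : rel V) : Prop :=
  forall c : seq V, ucycle A c -> c = [::].

Definition feedback_arc_set (V : finType) (A : rel V) (F : {set V * V}) : Prop :=
  F \subset arcs A /\ acyclic [rel u v | A u v && ((u, v) \notin F)].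

(* A directed triangle is represented by its set of arcs, so that the three
   rotations of (u, v, w) give one triangle. *)
Definition directed_triangles (V : finType) (A : rel V) : {set {set V * V}} :=
  [set D : {set V * V} | [exists u, exists v, exists w,
    [&& A u v, A v w, A w u & D == [set (u, v); (v, w); (w, u)]]]].

(* Each vertex of a directed triangle is the tail of one of its arcs. *)
Definition in_triangle (V : finType) (x : V) (D : {set V * V}) : Prop :=
  exists y : V, (x, y) \in D.

Definition is_module (V : finType) (A : rel V) (M : {set V}) : Prop :=
  {in M &, forall u v : V, outnbr A u :\: M = outnbr A v :\: M}.

Definition transitive_module (V : finType) (A : rel V) (M : {set V}) : Prop :=
  is_module A M /\ acyclic [rel u v in M | A u v].

Definition maximal_transitive_module (V : finType) (A : rel V)
    (M : {set V}) : Prop :=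
  transitive_module A M /\
  forall M' : {set V}, transitive_module A M' -> M \subset M' -> M' = M.

Definition module_in (V : finType) (A : rel V) (M : {set V}) : {set V} :=
  [set x | (x \notin M) && [forall m in M, A x m]].

Definition module_out (V : finType) (A : rel V) (M : {set V}) : {set V} :=
  [set x | (x \notin M) && [forall m in M, A m x]].

Definition module_back_arcs (V : finType) (A : rel V) (M : {set V}) :
    {set V * V} :=
  [set a in arcs A | (a.1 \in module_out A M) && (a.2 \in module_in A M)].

(* Main.v *)
(** Call a vertex affected if it is an endpoint of an arc of the feedback arc
    set [F]; at most [2k] vertices are.  Along an arc between unaffected
    vertices the set of affected in-neighbours can only grow, so these sets form
    a chain, and the unaffected vertices fall into at most [2k + 1] runs sharing
    the same set.  A run is a transitive module, contained in a maximal one [M].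
    Through an unaffected vertex [x] of [M], each arc of the set [Z] attached to
    [M] closes a triangle, which meets [F]; as [x] is unaffected, the arc itself
    is in [F].  Hence a run of size [n] has at least [n] triangles with apex [x]
    and base in [F] for each of its [n] vertices [x].  There are at most [k ^ 2]
    such triangles in all, so the sum of the [n ^ 2] is at most [k ^ 2], and by
    Cauchy-Schwarz there are at most [sqrt (2k + 1) * k] unaffected vertices. *)

Require Import Defs.
From mathcomp Require Import all_boot all_order all_algebra.
From mathcomp Require Import boolp reals.
From mathcomp Require Import zify lra.

Set Implicit Arguments.
Unset Strict Implicit.
Unset Printing Implicit Defensive.

Import GRing.Theory Num.Theory.

Lemma tournamentN (V : finType) (A : rel V) (u v : V) :
  tournament A -> u != v -> A v u = ~~ A u v.
Proof. by case=> _ /[apply]; case: (A u v); case: (A v u). Qed.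

Lemma arc_neq (V : finType) (A : rel V) (u v : V) :
  tournament A -> A u v -> u != v.
Proof. by case=> irrA _ uv; apply: contraTneq uv => ->; rewrite irrA. Qed.

Lemma fas_meets_triangle (V : finType) (A : rel V) (F : {set V * V}) (u v w : V) :
  tournament A -> feedback_arc_set A F -> A u v -> A v w -> A w u ->
  [|| (u, v) \in F, (v, w) \in F | (w, u) \in F].
Proof.
move=> tA [_ acF] uv vw wu; apply: contraT; rewrite !negb_or => /and3P[Fuv Fvw Fwu].
suff /acF : ucycle [rel x y | A x y && ((x, y) \notin F)] [:: u; v; w] by [].
rewrite /ucycle /= uv vw wu Fuv Fvw Fwu /= !inE negb_or.
by rewrite (arc_neq tA uv) (arc_neq tA vw) eq_sym (arc_neq tA wu).
Qed.

Definition affected (V : finType) (F : {set V * V}) : {set V} :=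
  [set e.1 | e in F] :|: [set e.2 | e in F].

Lemma card_affected (V : finType) (F : {set V * V}) : #|affected F| <= #|F|.*2.
Proof.
rewrite -addnn (leq_trans (leq_card_setU _ _)) //.
by apply: leq_add; apply: leq_imset_card.
Qed.

Lemma unaffectedl (V : finType) (F : {set V * V}) (x y : V) :
  x \notin affected F -> (x, y) \notin F.
Proof.
by apply: contra => Fxy; rewrite inE; apply/orP; left; apply/imsetP; exists (x, y).
Qed.

Lemma unaffectedr (V : finType) (F : {set V * V}) (x y : V) :
  x \notin affected F -> (y, x) \notin F.
Proof.
by apply: contra => Fyx; rewrite inE; apply/orP; right; apply/imsetP; exists (y, x).
Qed.

Lemma unaffected_triangle (V : finType) (A : rel V) (F : {set V * V}) (u v x : V) :
  tournament A -> feedback_arc_set A F -> x \notin affected F ->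
  A u v -> A v x -> A x u -> (u, v) \in F.
Proof.
move=> tA fF Ux uv vx xu; have := fas_meets_triangle tA fF uv vx xu.
by rewrite (negPf (unaffectedl _ Ux)) (negPf (unaffectedr _ Ux)) !orbF.
Qed.

Definition affected_in (V : finType) (A : rel V) (F : {set V * V}) (x : V) : {set V} :=
  [set a in affected F | A a x].

(** Were [a] an in-neighbour of [x] but not of [y], then [a], [x], [y] would form a directed
    triangle whose arcs all have an unaffected endpoint and so avoid [F]. *)
Lemma affected_in_sub (V : finType) (A : rel V) (F : {set V * V}) (x y : V) :
  tournament A -> feedback_arc_set A F -> x \notin affected F -> y \notin affected F ->
  A x y -> affected_in A F x \subset affected_in A F y.
Proof.
move=> tA fF Ux Uy xy; apply/subsetP => a; rewrite !inE => /andP[aF ax].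
rewrite aF /=; apply: contraT => nay.
have ay : y != a by apply: contraNneq Uy => ->; rewrite inE.
have ya : A y a by move: nay; rewrite (tournamentN tA ay) negbK.
by have := unaffected_triangle tA fF Uy ax xy ya; rewrite (negPf (unaffectedr _ Ux)).
Qed.

(* In a chain of sets the cardinality determines the set. *)
Definition run (V : finType) (A : rel V) (F : {set V * V}) (j : nat) : {set V} :=
  [set x in ~: affected F | #|affected_in A F x| == j].

Lemma in_run (V : finType) (A : rel V) (F : {set V * V}) (j : nat) (x : V) :
  (x \in run A F j) = (x \notin affected F) && (#|affected_in A F x| == j).
Proof. by rewrite in_set in_setC. Qed.

Lemma in_affected_in (V : finType) (A : rel V) (F : {set V * V}) (x a : V) :
  (a \in affected_in A F x) = (a \in affected F) && A a x.
Proof. by rewrite in_set. Qed.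

Lemma run_transitive_module (V : finType) (A : rel V) (F : {set V * V}) (j : nat) :
  tournament A -> feedback_arc_set A F -> transitive_module A (run A F j).
Proof.
move=> tA fF.
have out_sub u v : u \in run A F j -> v \in run A F j ->
    outnbr A u :\: run A F j \subset outnbr A v :\: run A F j.
  move=> ru rv; apply/subsetP => z /setDP[]; rewrite inE => uz nrz.
  apply/setDP; split=> //; rewrite inE; apply: contraT => nvz.
  have vz : v != z by apply: contraNneq nrz => <-.
  have zv : A z v by rewrite (tournamentN tA vz).
  move: ru rv nrz; rewrite !in_run => /andP[Uu /eqP ju] /andP[Uv /eqP jv].
  have [Fz _|Uz] := boolP (z \in affected F).
  (* One set includes the other and both have [j] elements, so they agree. Hence [z -> v] forces
     [z -> u], against [u -> z]. *)
  - have eqS : affected_in A F u = affected_in A F v.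
      have [uv|nuv] := boolP (A u v).
        by apply/eqP; rewrite eqEcard affected_in_sub // ju jv leqnn.
      have [->//|neq_uv] := eqVneq u v.
      apply/esym/eqP; rewrite eqEcard affected_in_sub ?ju ?jv //=.
      by rewrite (tournamentN tA neq_uv).
    have : z \in affected_in A F v by rewrite in_affected_in Fz.
    rewrite -eqS in_affected_in Fz (tournamentN tA) ?uz //.
    exact: arc_neq tA uz.
  (* Here [u -> z -> v] with all three unaffected: the count of [z] is squeezed between two counts
     equal to [j], which puts [z] in the run. *)
  rewrite /= => /negP[]; rewrite eqn_leq -{1}jv -{1}ju.
  by rewrite !subset_leq_card // affected_in_sub.
split=> [u v ru rv|c /andP[cyc uc]]; first by apply/eqP; rewrite eqEsubset !out_sub.
(* No arc inside a run is in [F], so a cycle there would survive the removal of [F]. *)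
apply: fF.2; rewrite /ucycle uc andbT; apply: sub_cycle cyc => u v /=.
case/andP=> /andP[]; rewrite in_run => /andP[Uu _] _ ->.
exact: unaffectedl Uu.
Qed.

Lemma sub_maximal_transitive_module (V : finType) (A : rel V) (M : {set V}) :
  transitive_module A M ->
  exists2 M' : {set V}, maximal_transitive_module A M' & M \subset M'.
Proof.
move=> /asboolP tM.
have [M' /maxsetP[/asboolP tM' maxM'] sub] :=
  @maxset_exists _ (fun X => `[< transitive_module A X >]) _ tM.
by exists M' => //; split=> // X /asboolP; apply: maxM'.
Qed.

Definition apex_arcs (V : finType) (A : rel V) (F : {set V * V}) (x : V) :
    {set V * V} :=
  [set e in F | A e.2 x && A x e.1].

Lemma back_arcs_sub_apex_arcs (V : finType) (A : rel V) (F : {set V * V})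
    (M : {set V}) (x : V) :
  tournament A -> feedback_arc_set A F -> x \notin affected F -> x \in M ->
  module_back_arcs A M \subset apex_arcs A F x.
Proof.
move=> tA fF Ux Mx; apply/subsetP => -[u v]; rewrite !inE /=.
case/and3P=> uv /andP[_ /forall_inP/(_ x Mx) xu] /andP[_ /forall_inP/(_ x Mx) vx].
by rewrite xu vx (unaffected_triangle tA fF Ux).
Qed.

Lemma card_apexes (V : finType) (A : rel V) (e : V * V) :
  tournament A -> e \in arcs A ->
  #|[set x | A e.2 x && A x e.1]| <= #|[set D in directed_triangles A | e \in D]|.
Proof.
case: e => u v tA; rewrite inE /= => uv.
pose tri x : {set V * V} := [set (u, v); (v, x); (x, u)].
rewrite -(card_in_imset (f := tri)).
  apply/subset_leq_card/subsetP => D /imsetP[x]; rewrite inE => /andP[vx xu] ->.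
  rewrite !inE eqxx !andbT.
  apply/existsP; exists u; apply/existsP; exists v; apply/existsP; exists x.
  by rewrite uv vx xu eqxx.
move=> x y; rewrite !inE => /andP[vx xu] /andP[vy yu] eqT.
(* The arc leaving [v] recovers the apex of a triangle on the base [(u, v)]. *)
have : (v, x) \in tri y by rewrite -eqT !inE eqxx orbT.
rewrite !inE !xpair_eqE eqxx [v == u]eq_sym (negPf (arc_neq tA uv)) /=.
case/orP=> [/eqP//|/andP[_ /eqP xeq]].
by move: (arc_neq tA xu); rewrite xeq eqxx.
Qed.

(** Double counting of pairs of an apex and a base in [F]: each base lies in at most [k]
    triangles. *)
Lemma sum_apex_arcs (V : finType) (A : rel V) (F : {set V * V}) (k : nat) :
  tournament A -> F \subset arcs A ->
  (forall a : V * V, a \in arcs A ->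
     #|[set D in directed_triangles A | a \in D]| <= k) ->
  \sum_(x : V) #|apex_arcs A F x| <= #|F| * k.
Proof.
move=> tA sFA tri_le.
have -> : \sum_x #|apex_arcs A F x| = \sum_(e in F) #|[set x | A e.2 x && A x e.1]|.
  rewrite [RHS](eq_bigr (fun e => \sum_(x | A e.2 x && A x e.1) 1)); last first.
    by move=> e _; rewrite sum1dep_card.
  rewrite (exchange_big_dep xpredT) //=; apply: eq_bigr => x _.
  by rewrite -sum1dep_card.
rewrite -sum_nat_const; apply: leq_sum => e /(subsetP sFA) Ae.
exact: leq_trans (card_apexes tA Ae) (tri_le e Ae).
Qed.

(** Cauchy-Schwarz against the constant 1. Once doubled, both sides are double sums, compared term
    by term through [2ab <= a^2 + b^2]. *)
Lemma sqrn_sum_leq (m : nat) (f : 'I_m -> nat) :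
  (\sum_i f i) ^ 2 <= m * \sum_i f i ^ 2.
Proof.
rewrite -(leq_pmul2l (isT : 0 < 2)) expnS expn1 big_distrlr big_distrr /=.
have -> : 2 * (m * \sum_i f i ^ 2) = \sum_i \sum_j (f i ^ 2 + f j ^ 2).
  under [RHS]eq_bigr do rewrite big_split /= sum_nat_const card_ord.
  by rewrite big_split /= sum_nat_const card_ord -big_distrr /= mul2n addnn.
apply: leq_sum => i _; rewrite big_distrr /=; apply: leq_sum => j _.
exact: nat_Cauchy.
Qed.

Lemma card_run_leq (V : finType) (A : rel V) (F : {set V * V}) (x : V) :
  tournament A -> feedback_arc_set A F ->
  (forall M : {set V}, maximal_transitive_module A M ->
     #|M| <= #|module_back_arcs A M|) ->
  x \notin affected F ->
  #|run A F #|affected_in A F x| | <= #|apex_arcs A F x|.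
Proof.
move=> tA fF maxM Ux.
have [M mM sM] := sub_maximal_transitive_module
  (run_transitive_module #|affected_in A F x| tA fF).
apply: leq_trans (subset_leq_card sM) _; apply: leq_trans (maxM M mM) _.
apply: subset_leq_card; apply: back_arcs_sub_apex_arcs => //.
by apply: (subsetP sM); rewrite in_run Ux eqxx.
Qed.

Lemma unaffected_bound (V : finType) (A : rel V) (F : {set V * V}) (k : nat) :
  tournament A -> feedback_arc_set A F -> #|F| <= k ->
  (forall a : V * V, a \in arcs A ->
     #|[set D in directed_triangles A | a \in D]| <= k) ->
  (forall M : {set V}, maximal_transitive_module A M ->
     #|M| <= #|module_back_arcs A M|) ->
  #|~: affected F| ^ 2 <= k.*2.+1 * k ^ 2.
Proof.
move=> tA fF Fk tri_le maxM.
(* The count is at most [#|affected F| <= 2k], so [inord] never falls back on its default value. *)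
pose idx x : 'I_k.*2.+1 := inord #|affected_in A F x|.
have idxE x : idx x = #|affected_in A F x| :> nat.
  rewrite inordK // ltnS (leq_trans _ (leq_trans (card_affected F) _)) ?leq_double //.
  by apply/subset_leq_card/subsetP => a; rewrite in_affected_in => /andP[].
have runE (j : 'I_k.*2.+1) : #|run A F j| = \sum_(x in ~: affected F | idx x == j) 1.
  rewrite sum1dep_card; apply: eq_card => x.
  by rewrite in_run !inE -idxE.
have -> : #|~: affected F| = \sum_(j < k.*2.+1) #|run A F j|.
  rewrite -sum1_card (partition_big idx predT) //=.
  by apply: eq_bigr => j _; rewrite runE.
apply: leq_trans (sqrn_sum_leq _) _; rewrite leq_mul2l; apply/orP; right.
(* A run of size [n] contributes [n] once for each of its [n] vertices. *)
have -> : \sum_(j < k.*2.+1) #|run A F j| ^ 2 =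
    \sum_(x in ~: affected F) #|run A F #|affected_in A F x| |.
  rewrite [RHS](partition_big idx predT) //=; apply: eq_bigr => j _.
  rewrite expnS expn1 {1}runE big_distrl /=; apply: eq_bigr => x /andP[_ /eqP<-].
  by rewrite mul1n idxE.
rewrite expnS expn1.
apply: leq_trans (_ : #|F| * k <= _); last by rewrite leq_mul2r Fk orbT.
apply: leq_trans (sum_apex_arcs tA fF.1 tri_le).
rewrite big_mkcond /=; apply: leq_sum => x _; case: ifP => //.
by rewrite in_setC => Ux; apply: card_run_leq.
Qed.

Theorem theorem1 (R : realType) :
  exists C : R, (0 < C)%R /\
    forall (V : finType) (A : rel V) (k : nat),
      tournament A ->
      0 < k ->
      (exists F : {set V * V}, feedback_arc_set A F /\ #|F| <= k) ->
      (forall x : V, exists D : {set V * V},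
         D \in directed_triangles A /\ in_triangle x D) ->
      (forall a : V * V, a \in arcs A ->
         #|[set D in directed_triangles A | a \in D]| <= k) ->
      (forall M : {set V}, maximal_transitive_module A M ->
         #|M| <= #|module_back_arcs A M|) ->
      (#|V|%:R <= C * (k%:R * Num.sqrt k%:R))%R.
Proof.
(* Affected and unaffected vertices each number at most [2 k sqrt k]. *)
exists 4%:R%R; split=> [|V A k tA k_gt0 [F [fF Fk]] _ tri_le maxM].
  by rewrite ltr0n.
have sqU := unaffected_bound tA fF Fk tri_le maxM.
have cardV : #|V| <= k.*2 + #|~: affected F|.
  rewrite -(cardsC (affected F)) leq_add2r (leq_trans (card_affected F)) //.
  by rewrite leq_double.
set n := #|~: affected F| in sqU cardV.
(* As [k] is positive, [2k + 1 <= 4k]. *)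
have sqU4 : n ^ 2 <= 4 * k ^ 3.
  apply: leq_trans sqU _; rewrite (expnS k 2) mulnA leq_mul2r.
  by apply/orP; right; lia.
have k_ge1 : (1 <= k%:R :> R)%R by rewrite ler1n.
set s := Num.sqrt (k%:R : R)%R.
have s_ge1 : (1 <= s)%R by rewrite -sqrtr1 ler_wsqrtr.
have sE : (s ^+ 2 = k%:R)%R by rewrite sqr_sqrtr ?ler0n.
have n_le : (n%:R <= 2%:R * (k%:R * s))%R.
  rewrite -ler_sqr ?nnegrE ?mulr_ge0 ?ler0n //; last lra.
  rewrite !exprMn sE -!natrX -!natrM ler_nat.
  by rewrite (leq_trans sqU4) // expnSr.
move: cardV; rewrite -(ler_nat R) natrD -mul2n natrM => cardV.
(* The term [2k] is absorbed into [2 k s] because [s >= 1]. *)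
nra.
Qed.
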